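(* Let $\mathcal H$ be an infinite dimensional separable complex Hilbert space and let $T$ be a bounded linear operator on $\mathcal H$. Suppose that $T$ satisfies the Diskcyclicity Criterion and that there is a normalized basic sequence $\{u_m\}$ in $\mathcal H$ such that $\lim_{m\to\infty}Tu_m=0$. Then there is an infinite dimensional closed linear subspace of $\mathcal H$ all of whose non-zero elements are diskcyclic vectors for $T$.
   Context: A vector $x\in\mathcal H$ is diskcyclic for $T$ if $\{\alpha T^n x : n\ge 0,\ \alpha\in\mathbb C,\ |\alpha|\le 1\}$ is dense in $\mathcal H$. $T$ satisfies the Diskcyclicity Criterion if there exist an increasing sequence of positive integers $\{n_k\}$, two dense sets $X,Y\subset\mathcal H$ and a sequence of maps $S_{n_k}:Y\to\mathcal H$ (not assumed linear or continuous) such that, as $k\to\infty$: (1) $\|T^{n_k}x\|\,\|S_{n_k}y\|\to 0$ for all $x\in X$, $y\in Y$; (2) $\|S_{n_k}y\|\to 0$ for all $y\in Y$; (3) $T^{n_k}S_{n_k}y\to y$ for all $y\in Y$. A normalized basic sequence is a sequence of unit vectors that is a Schauder basis of its closed linear span. *)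

(* Defs.v *)
From HB Require Import structures.
From mathcomp Require Import all_boot all_order all_algebra.
From mathcomp Require Import sesquilinear.
From mathcomp Require Import all_classical all_reals all_analysis.
From mathcomp Require Import complex.

Set Implicit Arguments.
Unset Strict Implicit.
Unset Printing Implicit Defensive.

Import Order.TTheory GRing.Theory Num.Theory.
Import numFieldNormedType.Exports.

Local Open Scope classical_set_scope.
Local Open Scope ring_scope.
Local Open Scope complex_scope.

Section Defs.
Context (R : realType) (H : normedModType R[i]).
Implicit Types (A W : set H) (T : H -> H) (u : nat -> H).

Definition linear_span A : set H :=
  [set x | exists (n : nat) (a : 'I_n -> R[i]) (e : 'I_n -> H),
    (forall i, A (e i)) /\ x = \sum_(i < n) a i *: e i].

Definition closed_linear_subspace W :=
  closed W /\ submod_closed (mem W).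

Definition finite_dimensional W :=
  exists2 F : set H, finite_set F & W = linear_span F.

Definition infinite_dimensional W := ~ finite_dimensional W.

Definition separable_space := exists2 D : set H, countable D & dense D.

Definition bounded_operator (T : {linear H -> H}) :=
  exists M : R, forall x, `|T x| <= M%:C * `|x|.

Definition schauder_basis u W :=
  (forall m, W (u m)) /\
  forall x, W x ->
    exists! a : nat -> R[i], series (fun m => a m *: u m) @ \oo --> x.

Definition normalized_basic_sequence u :=
  (forall m, `|u m| = 1) /\
  schauder_basis u (closure (linear_span (range u))).

Definition diskcyclic T (x : H) :=
  dense [set z | exists (n : nat) (a : R[i]),
    `|a| <= 1 /\ z = a *: iter n T x].

(* Only the values of [S (n k)] on [Y] are constrained, so total maps encode
   maps Y -> H.  The limit in the first condition is taken in [R[i]^o] because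
   the library puts the norm topology on the regular algebra; the norms
   themselves are elements of [R[i]]. *)
Definition diskcyclicity_criterion T :=
  exists (n : nat -> nat) (X Y : set H) (S : nat -> H -> H),
    [/\ (forall k, (0 < n k)%N) /\ {homo n : j k / (j < k)%N},
        dense X /\ dense Y,
        forall x y, X x -> Y y ->
          `|iter (n k) T x| * `|S (n k) y| @[k --> \oo] --> (0 : R[i]^o),
        forall y, Y y -> S (n k) y @[k --> \oo] --> (0 : H) &
        forall y, Y y -> iter (n k) T (S (n k) y) @[k --> \oo] --> y].

End Defs.

(* Main.v *)
(** Uniqueness of expansions and Baire's theorem (through the open mapping
    argument) bound the coefficient functionals of the basic sequence [u]
    uniformly.  Hence a suitable combination of late members of [u] is a unit
    vector orthogonal to any given finite family on which [T] is as small as we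
    like.  Recursively choose orthonormal [e_s], approximations [x_s] of [e_s]
    in [X], and small corrections [w_s] in [X], together with scalars
    [|a_s| <= 1] and times [n_s] such that [a_s T^(n_s) w_s] is close to a
    prescribed target [d_s], while [a_s T^(n_s)] is small on every other [x_j]
    and [w_r], earlier or later.  The corrections are distributed over the
    coordinates by a schedule [idx]: the operator
    [q |-> q + sum_r (<q,e_r> (x_r - e_r) + <q,e_(idx r)> w_r)]
    is a small perturbation of the identity, and the image of the closed span of
    the [e_j] is the required subspace, because [a_s T^(n_s)] maps the image of
    [q] to approximately [<q,e_(idx s)> d_s]. *)
Require Import Defs.
From mathcomp Require Import all_boot all_order all_algebra.
From mathcomp Require Import sesquilinear.
From mathcomp Require Import all_classical all_reals all_analysis.
From mathcomp Require Import complex.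
From mathcomp Require Import ring lra.

Set Implicit Arguments.
Unset Strict Implicit.
Unset Printing Implicit Defensive.

Import Order.TTheory GRing.Theory Num.Theory.
Import numFieldNormedType.Exports.

Local Open Scope classical_set_scope.
Local Open Scope ring_scope.
Local Open Scope complex_scope.

(* The library norm is valued in R[i]; this is the same number in R. *)
Definition nrm {R : realType} {V : normedZmodType R[i]} (x : V) : R :=
  complex.Re `|x|.

(** * Real-valued norms *)

Section RealNorm.
Context {R : realType} {V : normedZmodType R[i]}.
Implicit Types x y : V.

Lemma normE x : `|x| = (nrm x)%:C.
Proof. by rewrite /nrm RRe_real. Qed.

Lemma nrm_ge0 x : 0 <= nrm x.
Proof. by rewrite -lecR -normE normr_ge0. Qed.

Lemma nrm0 : nrm (0 : V) = 0.
Proof. by rewrite /nrm normr0. Qed.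

Lemma nrm_eq0 x : (nrm x == 0) = (x == 0).
Proof.
apply/eqP/eqP => [h|->]; last exact: nrm0.
by apply/normr0_eq0; rewrite normE h.
Qed.

Lemma nrm_gt0 x : (0 < nrm x) = (x != 0).
Proof. by rewrite lt_def nrm_ge0 andbT nrm_eq0. Qed.

Lemma nrmN x : nrm (- x) = nrm x.
Proof. by rewrite /nrm normrN. Qed.

Lemma nrmB x y : nrm (x - y) = nrm (y - x).
Proof. by rewrite /nrm distrC. Qed.

Lemma le_nrmD x y : nrm (x + y) <= nrm x + nrm y.
Proof. by rewrite -lecR rmorphD /= -!normE ler_normD. Qed.

Lemma le_nrmB x y : nrm (x - y) <= nrm x + nrm y.
Proof. by rewrite -(nrmN y) le_nrmD. Qed.

Lemma nrm_dist x y z : nrm (x - z) <= nrm (x - y) + nrm (y - z).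
Proof. by rewrite -[x - z](subrKA y) le_nrmD. Qed.

Lemma nrm_sum n (F : 'I_n -> V) :
  nrm (\sum_i F i) <= \sum_i nrm (F i).
Proof.
elim/big_ind2: _ => [|a b c d h1 h2|//]; first by rewrite nrm0.
by apply: le_trans (le_nrmD _ _) _; rewrite lerD.
Qed.

End RealNorm.

Lemma nrmZ {R : realType} {V : normedModType R[i]} (a : R[i]) (x : V) :
  nrm (a *: x) = nrm a * nrm x.
Proof.
by apply: (@complexI R); rewrite rmorphM/= -!normE normrZ.
Qed.

Lemma nrm_real {R : realType} (a : R) : 0 <= a -> nrm a%:C = a.
Proof. by move=> a0; rewrite /nrm ger0_norm// lecR. Qed.

(** * Convergence, closure and density through the real-valued norm *)

Section RealNormTopology.
Context {R : realType} {H : normedModType R[i]}.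
Implicit Types (x y : H) (u : nat -> H) (A : set H).

Lemma gt0_complexP (e : R[i]) : 0 < e -> exists2 r : R, 0 < r & e = r%:C.
Proof.
move=> e0; exists (complex.Re e); last by rewrite RRe_real// gtr0_real.
by rewrite -ltcR RRe_real// gtr0_real.
Qed.

Lemma cvg_nrmP u x : u @ \oo --> x <->
  forall e : R, 0 < e -> exists m, forall n, (m <= n)%N -> nrm (u n - x) < e.
Proof.
rewrite cvgrPdist_lt; split=> h e e0.
  have /h[m _ hm] : 0 < e%:C by rewrite ltcR.
  by exists m => n mn; rewrite nrmB -ltcR -normE; exact: hm.
have [r r0 ->] := gt0_complexP e0.
have [m hm] := h _ r0.
by exists m => // n mn; rewrite /= normE ltcR nrmB; exact: hm.
Qed.

Lemma nbhs_nrmP x A : nbhs x A <->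
  exists2 e : R, 0 < e & forall y, nrm (x - y) < e -> A y.
Proof.
split=> [/nbhs_normP[e /= e0 h]|[e e0 h]].
  have [r r0 er] := gt0_complexP e0.
  by exists r => // y xy; apply: h; rewrite /ball_/= er normE ltcR.
apply/nbhs_normP; exists e%:C; first by rewrite /= ltcR.
by move=> y; rewrite /ball_/= normE ltcR; exact: h.
Qed.

Lemma closure_nrmP A x : closure A x <->
  forall e : R, 0 < e -> exists2 y, A y & nrm (x - y) < e.
Proof.
split=> [h e e0|h B /nbhs_nrmP[e e0 hB]].
  have [|y [Ay xy]] := h [set y | nrm (x - y) < e]; last by exists y.
  by apply/nbhs_nrmP; exists e.
by have [y Ay xy] := h _ e0; exists y; split=> //; exact: hB.
Qed.

Lemma dense_nrmP A : dense A <->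
  forall x (e : R), 0 < e -> exists2 y, A y & nrm (x - y) < e.
Proof.
split=> [h x e e0|h O [x Ox] oO].
  have [||y [xy Ay]] := h (interior [set y | nrm (x - y) < e]).
  - by exists x; apply/nbhs_nrmP; exists e.
  - exact: open_interior.
  - by exists y => //; exact: interior_subset xy.
have /nbhs_nrmP[e e0 hO] : nbhs x O by exact: open_nbhs_nbhs.
by have [y Ay xy] := h x _ e0; exists y; split=> //; exact: hO.
Qed.

End RealNormTopology.

(** The bounds on the steps telescope, so [r] serves both as a Cauchy rate and as a bound on the
    distance to the limit. *)
Lemma nrm_complete {R : realType} {H : completeNormedModType R[i]}
  (u : nat -> H) (r : nat -> R) :
  (forall e, 0 < e -> exists n, r n < e) ->
  (forall n, 0 <= r n) ->
  (forall n, nrm (u n.+1 - u n) <= r n - r n.+1) ->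
  exists x, forall n, nrm (u n - x) <= r n.
Proof.
move=> r_small r_ge0 hu.
have tele n k : nrm (u (n + k)%N - u n) <= r n - r (n + k)%N.
  elim: k => [|k IH]; first by rewrite addn0 !subrr nrm0.
  rewrite addnS; apply: le_trans (nrm_dist _ (u (n + k)%N) _) _.
  by have := hu (n + k)%N; lra.
have /cvg_ex[x /cvg_nrmP ux] : cvg (u @ \oo).
  apply/cauchy_cvgP/cauchy_exP => e e0.
  have [d d0 ->] := gt0_complexP e0.
  have [n rn] := r_small _ d0.
  exists (u n); exists n => // m /= nm.
  rewrite -ball_normE /ball_/= normE ltcR nrmB -(subnKC nm).
  by apply: le_lt_trans (tele _ _) _; have := r_ge0 (n + (m - n))%N; lra.
exists x => n; apply/ler_addgt0Pr => e e0.
have [m hm] := ux _ e0.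
apply: le_trans (nrm_dist _ (u (n + m)%N) _) _; apply: lerD.
  by rewrite nrmB; apply: le_trans (tele _ _) _; have := r_ge0 (n + m)%N; lra.
exact/ltW/hm/leq_addl.
Qed.

Lemma exp2N_small {R : realType} (e : R) : 0 < e -> exists n, 2^-1 ^+ n < e.
Proof.
move=> e0; exists (Num.truncn e^-1).+1.
rewrite exprVn -[ltRHS]invrK ltf_pV2 ?posrE ?invr_gt0 ?exprn_gt0//.
apply: lt_trans (truncnS_gt _) _.
by rewrite -natrX ltr_nat ltn_expl.
Qed.

Lemma exp2N_smallM {R : realType} (C e : R) : 0 < e ->
  exists n, C * 2^-1 ^+ n < e.
Proof.
move=> e0; have C0 : 0 < `|C| + 1 by rewrite ltr_wpDl.
have [|n hn] := @exp2N_small R (e / (`|C| + 1)); first by rewrite divr_gt0.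
exists n; move: hn; rewrite ltr_pdivlMr//; apply: le_lt_trans.
rewrite mulrC ler_wpM2l ?exprn_ge0 ?invr_ge0//.
by apply: le_trans (ler_norm _) _; rewrite lerDl.
Qed.

Lemma exp2N_gt0 {R : realType} n : 0 < 2^-1 ^+ n :> R.
Proof. by rewrite exprn_gt0// invr_gt0. Qed.

Lemma exp2NS {R : realType} n : 2^-1 ^+ n.+1 = 2^-1 ^+ n / 2 :> R.
Proof. by rewrite exprSr. Qed.

(** * Baire's theorem and coefficients in a Schauder basis *)

(** Nested balls with centres in [W]: if no [A k] were dense in a relative ball, each ball could be
    shrunk to one that misses the next [A k], and the centres would converge to an uncovered point
    of [W]. *)
Lemma closed_Baire {R : realType} {H : completeNormedModType R[i]}
  (W : set H) (A : nat -> set H) :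
  closed W -> W !=set0 -> W `<=` \bigcup_k A k ->
  exists k x0 (d : R), [/\ W x0, 0 < d &
    forall x, W x -> nrm (x - x0) < d -> closure (A k) x].
Proof.
move=> clW [w Ww] WA; apply: contrapT => nex.
(* [p] is a centre with a radius. The conditions on [p] stand behind the existential so that
   [choice] yields a total function. *)
have step (k : nat) (p : H * R) : exists q : H * R, W p.1 -> 0 < p.2 ->
    [/\ W q.1, 0 < q.2, nrm (q.1 - p.1) <= p.2 - q.2, q.2 <= p.2 / 2 &
        forall y, nrm (q.1 - y) <= q.2 -> ~ A k y].
  case: p => x d /=; have [[Wx d0]|] := pselect (W x /\ 0 < d); last first.
    by move=> h; exists (x, d) => ? ?; exfalso; apply: h.
  have [y [Wy yx nA]] :
      exists y, [/\ W y, nrm (y - x) < d / 2 & ~ closure (A k) y].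
    apply: contrapT => h; apply: nex; exists k, x, (d / 2); split=> //.
      by rewrite divr_gt0.
    by move=> y Wy yx; apply: contrapT => nA; apply: h; exists y.
  have [r [r0 hr]] : exists r : R, 0 < r /\ forall z, nrm (y - z) < r -> ~ A k z.
    apply: contrapT => h; apply: nA; apply/closure_nrmP => e e0.
    apply: contrapT => h2; apply: h; exists e; split=> // z yz Az.
    by apply: h2; exists z.
  (* The bound [d / 2] nests the balls; [r / 2] keeps the new closed ball inside the open one that
     misses [A k]. *)
  exists (y, Num.min (d / 2) (r / 2)) => _ _ /=.
  have m1 : Num.min (d / 2) (r / 2) <= d / 2 by rewrite ge_min lexx.
  have m2 : Num.min (d / 2) (r / 2) <= r / 2 by rewrite ge_min lexx orbT.
  split=> //; [by rewrite lt_min !divr_gt0| lra |].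
  by move=> z yz; apply: hr; lra.
have [f hf] := choice (fun kp => step kp.1 kp.2).
pose p := fix p n := if n is m.+1 then f (m, p m) else (w, 1).
have pP n : W (p n).1 /\ 0 < (p n).2.
  elim: n => [|n [IH1 IH2]]; first by split.
  by have [] := hf (n, p n) IH1 IH2.
have p_le n : (p n).2 <= 2^-1 ^+ n.
  elim: n => [|n IH]; first by rewrite expr0.
  have [_ _ _ h _] := hf (n, p n) (pP n).1 (pP n).2.
  by rewrite exp2NS; apply: le_trans h _; rewrite ler_pM2r// invr_gt0.
have [|||x hx] := @nrm_complete _ _ (fun n => (p n).1) (fun n => (p n).2).
- by move=> e /exp2N_small[n hn]; exists n; exact: le_lt_trans hn.
- by move=> n; exact: ltW (pP n).2.
- by move=> n; have [] := hf (n, p n) (pP n).1 (pP n).2.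
have Wx : W x.
  apply: clW; apply/closure_nrmP => e /exp2N_small[n hn].
  exists (p n).1; first exact: (pP n).1.
  by rewrite nrmB; apply: le_lt_trans (hx n) _; exact: le_lt_trans hn.
have [k _ Akx] := WA _ Wx.
have [_ _ _ _] := hf (k, p k) (pP k).1 (pP k).2.
by move=> /(_ x (hx k.+1)).
Qed.

(** * Orthogonality and projection onto a unit vector *)

Section InnerProduct.
Context {R : realType} {H : normedModType R[i]}.
Context (dot : {dot H for (@Num.conj R[i])}).
Hypothesis norm_dot : forall x : H, `|x| = sqrtC (dot x x).

Lemma dot_nrm x : dot x x = (nrm x ^+ 2)%:C.
Proof. by rewrite rmorphXn /= -normE norm_dot sqrtCK. Qed.

Lemma dotC0 x y : dot x y = 0 -> dot y x = 0.
Proof. by move=> h; rewrite hermC /= h rmorph0 mulr0. Qed.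

Lemma nrm_pythagoras x y : dot x y = 0 ->
  nrm (x + y) ^+ 2 = nrm x ^+ 2 + nrm y ^+ 2.
Proof.
move=> xy; apply: (@complexI R); rewrite rmorphD/= -!dot_nrm.
exact: hnormDd.
Qed.

Lemma le_nrm_orth x y : dot x y = 0 -> nrm x <= nrm (x + y).
Proof.
move=> xy; rewrite -(@ler_pXn2r _ 2) ?nnegrE ?nrm_ge0//.
by rewrite nrm_pythagoras// lerDl sqr_ge0.
Qed.

Lemma dot_proj_orth e x : nrm e = 1 -> dot (x - dot x e *: e) e = 0.
Proof.
by move=> e1; rewrite linearBl linearZl_LR/= dot_nrm e1 expr1n mulr1 subrr.
Qed.

Lemma nrm_sub_proj e x : nrm e = 1 -> nrm (x - dot x e *: e) <= nrm x.
Proof.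
move=> e1; rewrite -[x in leRHS](subrK (dot x e *: e)).
by apply: le_nrm_orth; rewrite linearZr_LR/= dot_proj_orth// mulr0.
Qed.

Lemma nrm_dot_unit e x : nrm e = 1 -> nrm (dot x e) <= nrm x.
Proof.
move=> e1; rewrite -[nrm (dot _ _)]mulr1 -e1 -nrmZ.
suff /le_nrm_orth : dot (dot x e *: e) (x - dot x e *: e) = 0 by rewrite subrKC.
by apply: dotC0; rewrite linearZr_LR/= dot_proj_orth// mulr0.
Qed.

End InnerProduct.

(** * Linear spans and closures of subspaces *)

Section Subspaces.
Context {R : realType} {H : normedModType R[i]}.
Implicit Types A W : set H.

Lemma linear_span_submod A : submod_closed (mem (linear_span A)).
Proof.
split.
  by rewrite inE; exists 0%N, (fun=> 0), (fun=> 0); split=> [[]//|]; rewrite big_ord0.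
move=> c x y; rewrite !inE => -[m [a [e [eA ->]]]] [n [b [f [fA ->]]]].
exists (m + n)%N.
exists (fun i => match fintype.split i with inl j => c * a j | inr k => b k end).
exists (fun i => match fintype.split i with inl j => e j | inr k => f k end); split.
  by move=> i; case: (fintype.split i).
rewrite big_split_ord/= scaler_sumr; congr +%R; apply: eq_bigr => i _.
  by rewrite (unsplitK (inl i)) scalerA.
by rewrite (unsplitK (inr i)).
Qed.

Lemma closure_submod W : submod_closed (mem W) -> submod_closed (mem (closure W)).
Proof.
move=> [W0 Wlin]; split.
  by rewrite inE; apply: subset_closure; move: W0; rewrite inE.
move=> c x y; rewrite !inE => /closure_nrmP clx /closure_nrmP cly.
apply/closure_nrmP => e e0.
have c0 : 0 < nrm c + 1 by rewrite ltr_wpDl// nrm_ge0.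
have [|x' Wx' xx'] := clx (e / 2 / (nrm c + 1)); first by rewrite !divr_gt0.
have [|y' Wy' yy'] := cly (e / 2); first by rewrite divr_gt0.
exists (c *: x' + y'); first by move: (Wlin c x' y'); rewrite !inE; exact.
rewrite opprD addrACA -scalerBr; apply: le_lt_trans (le_nrmD _ _) _.
rewrite nrmZ; move: xx'; rewrite ltr_pdivlMr// => xx'.
have := nrm_ge0 (x - x'); nra.
Qed.

End Subspaces.

(** * Uniform bound on the coefficients of a basic sequence *)

Section SchauderBasis.
Context {R : realType} {H : completeNormedModType R[i]}.
Context (dot : {dot H for (@Num.conj R[i])}).
Hypothesis norm_dot : forall x : H, `|x| = sqrtC (dot x x).
Context (u : nat -> H).
Implicit Types (a b : nat -> R[i]) (x y : H).

Let ps a n : H := \sum_(k < n) a k *: u k.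

Let psS a n : ps a n.+1 = ps a n + a n *: u n.
Proof. by rewrite /ps big_ord_recr. Qed.

Let W := closure (linear_span (range u)).

Let W_span a n : W (ps a n).
Proof.
apply: subset_closure; exists n, (fun i => a i), (fun i => u i).
by split=> // i; exists (i : nat).
Qed.

Let W_submod : submod_closed (mem W).
Proof. exact/closure_submod/linear_span_submod. Qed.

Let WB x y : W x -> W y -> W (x - y).
Proof.
move=> Wx Wy; have := W_submod.2 (-1) y x.
by rewrite !inE scaleN1r addrC; apply.
Qed.

Let WZ c x : W x -> W (c *: x).
Proof.
move=> Wx; have := W_submod.2 c x 0.
by rewrite !inE addr0; apply=> //; have := W_submod.1; rewrite inE.
Qed.

Let WD x y : W x -> W y -> W (x + y).
Proof.
by move=> Wx Wy; have := W_submod.2 1 x y; rewrite !inE scale1r; apply.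
Qed.

(** Bounding all partial sums measures [x] by the supremum of their norms; the open mapping argument
    compares this size with [nrm x]. *)
Let bounded_expansion (k : R) x a :=
  ps a @ \oo --> x /\ forall n, nrm (ps a n) <= k.

Let bexp k x := exists a, bounded_expansion k x a.

Let bexpB k l x y : bexp k x -> bexp l y -> bexp (k + l) (x - y).
Proof.
move=> [a [ax ak]] [b [b_y bl]].
have E n : ps (fun i => a i - b i) n = ps a n - ps b n.
  by rewrite /ps -sumrB; apply: eq_bigr => i _; rewrite scalerBl.
exists (fun i => a i - b i); split; last first.
  by move=> n; rewrite E; apply: le_trans (le_nrmB _ _) _; exact: lerD.
rewrite (_ : ps _ = fun n => ps a n - ps b n); last exact/funext.
exact: cvgB.
Qed.

Let bexpZ k c x : bexp k x -> bexp (nrm c * k) (c *: x).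
Proof.
move=> [a [ax ak]].
have E n : ps (fun i => c * a i) n = c *: ps a n.
  by rewrite /ps scaler_sumr; apply: eq_bigr => i _; rewrite scalerA.
exists (fun i => c * a i); split; last first.
  by move=> n; rewrite E nrmZ ler_wpM2l// nrm_ge0.
rewrite (_ : ps _ = fun n => c *: ps a n); last exact/funext.
exact: cvgZr.
Qed.

Hypothesis u1 : forall m, nrm (u m) = 1.
Hypothesis u_exp : forall x, W x -> exists a, ps a @ \oo --> x.

Let bexp_cover : W `<=` \bigcup_k bexp k%:R.
Proof.
move=> x /u_exp[a ax].
have /cvg_nrmP/(_ _ ltr01)[m hm] := ax.
exists (Num.truncn (\sum_(i < m) nrm (ps a i) + nrm x + 1)).+1 => //.
exists a; split=> // n.
apply: le_trans (ltW (truncnS_gt _)).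
have S0 : 0 <= \sum_(i < m) nrm (ps a i) by apply: sumr_ge0 => i _; exact: nrm_ge0.
have x0 := nrm_ge0 x.
have [mn|nm] := leqP m n.
  rewrite -[ps a n](subrK x); apply: le_trans (le_nrmD _ _) _.
  by have := hm _ mn; lra.
rewrite (bigD1 (Ordinal nm))//= -!addrA lerDl.
rewrite !addr_ge0// sumr_ge0// => i _; exact: nrm_ge0.
Qed.

(** Baire's theorem makes some [bexp k] dense in a relative ball about [x0]; differences of its
    points move the ball to the origin, and scaling handles every radius [t]. *)
Let approx : exists2 k : R, 0 <= k & forall x t e, W x -> nrm x < t -> 0 < e ->
  exists2 y, bexp (k * t) y & nrm (x - y) < e.
Proof.
have [||k [x0 [d [Wx0 d0 hd]]]] := closed_Baire _ _ bexp_cover.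
- exact: closed_closure.
- by exists 0; have := W_submod.1; rewrite inE.
exists ((k%:R + k%:R) / d) => [|x t e Wx xt e0].
  by rewrite divr_ge0 ?addr_ge0// ltW.
have t0 : 0 < t by apply: le_lt_trans xt; exact: nrm_ge0.
have dt0 : 0 < d / t by rewrite divr_gt0.
(* Two errors below this value, multiplied by [t / d], add up to less than [e]. *)
have s0 : 0 < e * (d / t) / 2 by apply: divr_gt0 => //; apply: mulr_gt0.
have ndt : nrm (d / t)%:C = d / t by rewrite nrm_real// ltW.
have /closure_nrmP/(_ _ s0)[y1 b1 h1] : closure (bexp k%:R) x0.
  by apply: hd => //; rewrite subrr nrm0.
have /closure_nrmP/(_ _ s0)[y2 b2 h2] :
    closure (bexp k%:R) (x0 + (d / t)%:C *: x).
  apply: hd; first by apply: WD => //; exact: WZ.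
  by rewrite addrAC subrr add0r nrmZ ndt mulrAC ltr_pdivrMr// ltr_pM2l.
have td : (t / d)%:C * (d / t)%:C = 1 :> R[i].
  by rewrite -rmorphM/= mulrA divfK ?gt_eqF// divff// gt_eqF.
exists ((t / d)%:C *: (y2 - y1)).
  have -> : (k%:R + k%:R) / d * t = nrm (t / d)%:C * (k%:R + k%:R).
    by rewrite nrm_real; [ring|rewrite divr_ge0// ltW].
  exact/bexpZ/bexpB.
rewrite -[X in X - _]scale1r -td -scalerA -scalerBr nrmZ.
rewrite nrm_real; last by rewrite divr_ge0// ltW.
have -> : (d / t)%:C *: x - (y2 - y1) =
    (x0 + (d / t)%:C *: x - y2) - (x0 - y1).
  by rewrite [x0 + _]addrC -(addrA _ x0) -addrA !opprB [(x0 - y2) + _]addrC subrKA.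
have h := le_nrmB (x0 + (d / t)%:C *: x - y2) (x0 - y1).
have -> : e = t / d * (e * (d / t)) by field; rewrite !gt_eqF.
rewrite ltr_pM2l ?divr_gt0//.
by apply: le_lt_trans h _; lra.
Qed.

(* Successive approximation: the approximants y_j are geometrically small, and
   the expansions of the y_j add up to an expansion of x. *)
Let bounded_expansion_exists : exists2 k : R, 0 <= k &
  forall x, W x -> nrm x < 1 -> bexp k x.
Proof.
have [k k0 happ] := approx; exists (2 * k); first by rewrite mulr_ge0.
move=> x Wx x1.
have step (p : nat * H) : exists y, W p.2 -> nrm p.2 < 2^-1 ^+ p.1 ->
    [/\ W y, bexp (k * 2^-1 ^+ p.1) y & nrm (p.2 - y) < 2^-1 ^+ p.1.+1].
  have [[h1 h2]|h] := pselect (W p.2 /\ nrm p.2 < 2^-1 ^+ p.1).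
    have [y [a [ya ak]] hy2] := happ _ _ _ h1 h2 (exp2N_gt0 p.1.+1).
    exists y => _ _; split=> //; last by exists a.
    apply: (@closed_cvg _ _ \oo _ (ps a)) ya; first exact: closed_closure.
    by apply: nearW => n; exact: W_span.
  by exists 0 => ? ?; exfalso; exact: h.
have [Y hY] := choice step.
pose res := fix res j := if j is i.+1 then res i - Y (i, res i) else x.
have resP j : W (res j) /\ nrm (res j) < 2^-1 ^+ j.
  elim: j => [|j [IH1 IH2]]; first by rewrite expr0.
  by have [Wy _ ?] := hY (j, res j) IH1 IH2; split=> //; exact: WB.
pose y j := Y (j, res j).
have yP j : bexp (k * 2^-1 ^+ j) (y j).
  by have [] := hY (j, res j) (resP j).1 (resP j).2.
have [a aP] := choice yP.
have sumy J : \sum_(j < J) y j = x - res J.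
  elim: J => [|J IH]; first by rewrite big_ord0 subrr.
  by rewrite big_ord_recr/= IH opprB addrA addrAC.
(* [S J n] is the partial sum at [n] of the combined expansions of the first [J] vectors [y j]. It
   converges in [J] uniformly in [n], so the two limits can be exchanged. *)
pose S J n : H := \sum_(j < J) ps (a j) n.
have SP n : exists p, forall J, nrm (S J n - p) <= 2 * k * 2^-1 ^+ J.
  apply: (@nrm_complete _ _ (S^~ n)).
  - by move=> e /(exp2N_smallM (2 * k)).
  - by move=> J; rewrite !mulr_ge0// ltW// exp2N_gt0.
  - move=> J; rewrite /S big_ord_recr/= addrAC subrr add0r exp2NS.
    by apply: le_trans ((aP J).2 n) _; rewrite mulrC; lra.
have [p hp] := choice SP.
have px : p @ \oo --> x.
  apply/cvg_nrmP => e e0.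
  have e3 : 0 < e / 3 by rewrite divr_gt0.
  have [J hJ] := exp2N_smallM (2 * k + 1) e3.
  have /cvg_nrmP/(_ _ e3)[m hm] : S J @ \oo --> \sum_(j < J) y j.
    elim: J {hJ} => [|J IH].
      rewrite (_ : S 0%N = cst 0) ?big_ord0; first exact: cvg_cst.
      by apply/funext => n; rewrite /S big_ord0.
    rewrite big_ord_recr/= (_ : S J.+1 = fun n => S J n + ps (a J) n).
      by apply: cvgD => //; exact: (aP J).1.
    by apply/funext => n; rewrite /S big_ord_recr.
  exists m => n mn; have := hm _ mn; rewrite sumy => h.
  have h1 := hp n J; have [_ h2] := resP J.
  have := exp2N_gt0 (R := R) J => h3.
  have -> : p n - x = (p n - S J n) + (S J n - (x - res J)) - res J.
    by rewrite subrKA opprD opprK addrA addrK.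
  apply: le_lt_trans (le_nrmB _ _) _.
  have := le_nrmD (p n - S J n) (S J n - (x - res J)); rewrite [nrm (p n - _)]nrmB.
  nra.
(* The increments of [S J] at [n] are multiples of the unit vector [u n], hence so is their limit;
   the inner product reads off its coefficient. *)
pose c n := dot (p n.+1 - p n) (u n).
have pS n : p n.+1 - p n = c n *: u n.
  apply/eqP; rewrite -subr_eq0 -nrm_eq0 eq_le nrm_ge0 andbT.
  apply/ler_addgt0Pr => e e0; rewrite add0r.
  have [J hJ] := exp2N_smallM (4 * k) e0.
  (* Removing the component along [u n] annihilates multiples of [u n], so the increment may be
     replaced by the small vector [v]. *)
  pose v := p n.+1 - p n - (\sum_(j < J) a j n) *: u n.
  have -> : p n.+1 - p n - c n *: u n = v - dot v (u n) *: u n.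
    rewrite /v linearBl/= linearZl_LR/= (dot_nrm norm_dot) u1 expr1n mulr1.
    by rewrite scalerBl opprB addrA subrK.
  apply: le_trans (nrm_sub_proj norm_dot _ (u1 n)) _.
  have -> : v = (p n.+1 - S J n.+1) - (p n - S J n).
    have -> : S J n.+1 = S J n + (\sum_(j < J) a j n) *: u n.
      by rewrite /S scaler_suml -big_split; apply: eq_bigr => j _; exact: psS.
    by rewrite opprD addrA [RHS]addrAC opprB addrA subrK.
  apply: le_trans (le_nrmB _ _) _.
  have := hp n J; have := hp n.+1 J; rewrite ![nrm (p _ - _)]nrmB; lra.
have p0 : p 0%N = 0.
  apply/eqP; rewrite -nrm_eq0 eq_le nrm_ge0 andbT.
  apply/ler_addgt0Pr => e e0; rewrite add0r.
  have [J hJ] := exp2N_smallM (2 * k) e0.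
  have := hp 0%N J; rewrite /S big1 ?sub0r ?nrmN; first by lra.
  by move=> j _; rewrite /ps big_ord0.
have pE : p = ps c.
  apply/funext; elim=> [|n IH]; first by rewrite p0 /ps big_ord0.
  by rewrite psS -IH -pS addrC subrK.
exists c; split; first by rewrite -pE.
move=> n; rewrite -pE; have := hp n 0%N.
by rewrite /S big_ord0 sub0r nrmN expr0 mulr1.
Qed.

Hypothesis u_uniq : forall x a b, ps a @ \oo --> x -> ps b @ \oo --> x -> a = b.

(** By uniqueness, the bounded expansion of a finite sum is that sum padded with zeros. A term is
    the difference of two successive partial sums, and [u m] is a unit vector. *)
Lemma schauder_coef_bound : exists2 C : R, 0 < C &
  forall n a m, (m < n)%N -> nrm (a m) <= C * nrm (\sum_(k < n) a k *: u k).
Proof.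
have [k k0 hk] := bounded_expansion_exists.
(* [hk] needs norm strictly below 1, so vectors are normalised by twice their norm; a term takes two
   partial sums, which gives [4 * k]. The [+ 1] makes the constant positive. *)
exists (4 * k + 1) => [|n a m mn]; first by rewrite ltr_wpDl// mulr_ge0.
pose b i := if (i < n)%N then a i else 0.
have psb N : (n <= N)%N -> ps b N = ps a n.
  elim: N => [|N IH]; first by rewrite leqn0 => /eqP ->; rewrite /ps !big_ord0.
  rewrite leq_eqVlt => /predU1P[<-|nN].
    by apply: eq_bigr => i _; rewrite /b ltn_ord.
  by rewrite psS IH// /b ltnNge -ltnS nN scale0r addr0.
have bx : ps b @ \oo --> ps a n.
  apply/cvg_nrmP => e e0; exists n => N nN.
  by rewrite psb// subrr nrm0.
have bound : bexp (2 * k * nrm (ps a n)) (ps a n).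
  have := nrm_ge0 (ps a n); rewrite le_eqVlt => /predU1P[/esym x0|x0].
    have /eqP xx : ps a n == 0 by rewrite -nrm_eq0 x0.
    rewrite x0 mulr0 xx; exists (fun=> 0); rewrite /bounded_expansion.
    have z N : ps (fun=> 0) N = 0 by rewrite /ps big1// => i _; rewrite scale0r.
    split; last by move=> N; rewrite z nrm0.
    by apply/cvg_nrmP => e e0; exists 0%N => N _; rewrite z subrr nrm0.
  set t := 2 * nrm (ps a n).
  have t0 : 0 < t by rewrite mulr_gt0.
  have nt : nrm t%:C = t by rewrite nrm_real// ltW.
  have ntV : nrm t^-1%:C = t^-1 by rewrite nrm_real// invr_ge0 ltW.
  have -> : ps a n = t%:C *: (t^-1%:C *: ps a n).
    by rewrite scalerA -rmorphM/= divff ?gt_eqF// scale1r.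
  have -> : 2 * k * nrm (t%:C *: (t^-1%:C *: ps a n)) = nrm t%:C * k.
    by rewrite !nrmZ nt ntV mulVKf ?gt_eqF// /t; ring.
  apply/bexpZ/hk; first exact: WZ.
  by rewrite nrmZ ntV ltr_pdivrMl// mulr1 /t; lra.
have [c [cx hc]] := bound.
have cb := u_uniq cx bx.
rewrite -[a m](_ : b m = _); last by rewrite /b mn.
rewrite -[nrm (b m)]mulr1 -[X in nrm _ * X](u1 m) -nrmZ -cb.
have -> : c m *: u m = ps c m.+1 - ps c m by rewrite psS addrAC subrr add0r.
apply: le_trans (le_nrmB _ _) _.
have := hc m; have := hc m.+1; have := nrm_ge0 (ps a n).
rewrite -[\sum_(i < n) _]/(ps a n); move: (nrm (ps a n)) => s; lra.
Qed.

End SchauderBasis.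

(** * Unit vectors on which the operator is small *)

(** A matrix with more rows than columns has a nonzero left kernel. *)
Lemma linear_relation (K : fieldType) n (g : 'I_n.+1 -> 'I_n -> K) :
  exists2 b : 'I_n.+1 -> K, (exists i, b i != 0) &
    forall j, \sum_i b i * g i j = 0.
Proof.
pose A := \matrix_(i, j) g i j.
have /rowV0Pn[v /sub_kermxP vA v0] : kermx A != 0.
  by rewrite kermx_eq0 /row_free neq_ltn ltnS rank_leq_col.
exists (v 0) => [|j]; first exact/rV0Pn.
have /rowP/(_ j) := vA; rewrite !mxE => h.
by rewrite -[RHS]h; apply: eq_bigr => i _; rewrite mxE.
Qed.

(** The coefficients of all [e i] equal to the same entry of [s] are collected at its first
    index. *)
Lemma linear_span_seq {R : realType} {H : normedModType R[i]} (s : seq H) x :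
  linear_span [set` s] x -> exists g : 'I_(size s) -> R[i],
    x = \sum_l g l *: s`_l.
Proof.
move=> [n [a [e [es ->]]]].
exists (fun l => \sum_(i < n | index (e i) s == l :> nat) a i).
under [RHS]eq_bigr do rewrite scaler_suml big_mkcond.
rewrite exchange_big/=; apply: eq_bigr => i _.
have lt_i : (index (e i) s < size s)%N by rewrite index_mem; exact: es.
rewrite -big_mkcond (big_pred1 (Ordinal lt_i)) /= => [|l].
  by rewrite nth_index//; exact: es.
by rewrite /= -val_eqE/= eq_sym.
Qed.

(** Along a spanning list [s], the coordinates of [(size s).+1] members of [z] satisfy a nontrivial
    linear relation, against independence. *)
Lemma infinite_dimensional_free {R : realType} {H : normedModType R[i]}
  (W : set H) (z : nat -> H) : (forall i, W (z i)) ->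
  (forall n (b : nat -> R[i]), \sum_(k < n) b k *: z k = 0 ->
    forall k, (k < n)%N -> b k = 0) ->
  infinite_dimensional W.
Proof.
move=> Wz z_free [_ /finite_seqP[s ->] WF].
have /choice[g hg] i : exists g : 'I_(size s) -> R[i], z i = \sum_l g l *: s`_l.
  by apply: linear_span_seq; rewrite -WF.
have [b [i0 bi0] hb] := linear_relation (fun i : 'I_(size s).+1 => g i).
case/eqP: bi0; rewrite -[i0]inord_val.
apply: (z_free (size s).+1 (fun k => b (inord k))) => //.
under eq_bigr => k _ do rewrite inord_val hg scaler_sumr.
rewrite exchange_big big1//= => l _.
by under eq_bigr do rewrite scalerA; rewrite -scaler_suml hb scale0r.
Qed.

Section SmallOrthogonalVector.
Context {R : realType} {H : normedModType R[i]}.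
Context (dot : {dot H for (@Num.conj R[i])}) (T : {linear H -> H}).

(** Orthogonality to [s] imposes [size s] linear conditions, so a nontrivial combination of
    [(size s).+1] late members of [u] meets them. The coefficient bound makes it nonzero and
    controls its image under [T]. *)
Lemma small_orth_unit (u : nat -> H) (C : R) :
  0 < C ->
  (forall n (a : nat -> R[i]) m, (m < n)%N ->
    nrm (a m) <= C * nrm (\sum_(k < n) a k *: u k)) ->
  T (u m) @[m --> \oo] --> (0 : H) ->
  forall (s : seq H) (e : R), 0 < e ->
  exists v, [/\ nrm v = 1, forall f, f \in s -> dot v f = 0 & nrm (T v) <= e].
Proof.
move=> C0 hC /cvg_nrmP Tu0 s e e0; set n := size s.
(* Each of the [n.+1] terms of [T x] then contributes at most [nrm x * e / n.+1%:R]. *)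
have [|M hM] := Tu0 (e / (C * n.+1%:R)); first by rewrite divr_gt0// mulr_gt0.
have [b [i0 bi0] hb] :=
  linear_relation (fun (i : 'I_n.+1) (j : 'I_n) => dot (u (M + i)%N) s`_j).
pose x := \sum_i b i *: u (M + i)%N.
have bx i : nrm (b i) <= C * nrm x.
  (* [hC] speaks of sums that start at 0, so the coefficients are shifted by [M] and padded with
     zeros. *)
  pose a k := if (M <= k)%N then b (inord (k - M)) else 0.
  have := hC (M + n.+1)%N a (M + i)%N; rewrite ltn_add2l => /(_ (ltn_ord i)).
  rewrite {1}/a leq_addr addKn inord_val big_split_ord/= big1 ?add0r => [|j _].
    rewrite (_ : \sum_(j < _) _ = x)//; apply: eq_bigr => j _.
    by rewrite /a leq_addr addKn inord_val.
  by rewrite /a leqNgt ltn_ord scale0r.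
have x0 : 0 < nrm x.
  rewrite nrm_gt0; apply: contra bi0 => /eqP x0.
  by have := bx i0; rewrite x0 nrm0 mulr0 -nrm_eq0 eq_le nrm_ge0 andbT.
have nV : nrm (nrm x)^-1%:C = (nrm x)^-1 by rewrite nrm_real// invr_ge0 ltW.
exists ((nrm x)^-1%:C *: x); split.
- by rewrite nrmZ nV mulVf// gt_eqF.
- move=> f /(nthP 0)[j jn <-].
  rewrite linearZl_LR/= (_ : dot x _ = 0) ?mulr0//.
  rewrite linear_sumlz -[RHS](hb (Ordinal jn)).
  by apply: eq_bigr => i _; rewrite linearZl_LR.
- rewrite linearZ nrmZ nV ler_pdivrMl// linear_sum.
  apply: le_trans (nrm_sum _) _.
  apply: (@le_trans _ _ (\sum_(i < n.+1) nrm x * e / n.+1%:R)).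
    apply: ler_sum => i _; rewrite linearZ nrmZ.
    have -> : nrm x * e / n.+1%:R = C * nrm x * (e / (C * n.+1%:R)).
      have : n.+1%:R != 0 :> R by rewrite pnatr_eq0.
      by move: (n.+1%:R) => N N0; field; rewrite N0 gt_eqF.
    apply: ler_pM; rewrite ?nrm_ge0//.
    by have := hM _ (leq_addr i M); rewrite subr0 => /ltW.
  by rewrite sumr_const card_ord -[leLHS]mulr_natr divfK// pnatr_eq0.
Qed.

End SmallOrthogonalVector.

(** * Diskcyclicity *)

Section Iterates.
Context {R : realType} {H : normedModType R[i]} (T : {linear H -> H}).

Lemma iter_linearP n (a : R[i]) x y :
  iter n T (a *: x + y) = a *: iter n T x + iter n T y.
Proof. by elim: n => //= n ->; rewrite linearP. Qed.

Lemma iter_linear0 n : iter n T 0 = 0.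
Proof. by elim: n => //= n ->; rewrite linear0. Qed.

Lemma iter_linearZ n (a : R[i]) x : iter n T (a *: x) = a *: iter n T x.
Proof. by have := iter_linearP n a x 0; rewrite !addr0 iter_linear0 addr0. Qed.

Lemma iter_linearD n x y : iter n T (x + y) = iter n T x + iter n T y.
Proof. by have := iter_linearP n 1 x y; rewrite !scale1r. Qed.

Lemma iter_linearB n x y : iter n T (x - y) = iter n T x - iter n T y.
Proof. by rewrite addrC -scaleN1r iter_linearP scaleN1r addrC. Qed.

(** A bound of at least 1 has nondecreasing powers, so one power controls all iterates up to a given
    time. *)
Lemma bounded_operator_ge1 : bounded_operator T ->
  exists2 M : R, 1 <= M & forall x, nrm (T x) <= M * nrm x.
Proof.
move=> [M hM]; exists (Num.max 1 M); first by rewrite le_max lexx.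
move=> x; apply: (@le_trans _ _ (M * nrm x)).
  by have := hM x; rewrite !normE -rmorphM lecR.
by rewrite ler_wpM2r ?nrm_ge0// le_max lexx orbT.
Qed.

Context (M : R) (M1 : 1 <= M) (TM : forall x, nrm (T x) <= M * nrm x).

Lemma nrm_iter n x : nrm (iter n T x) <= M ^+ n * nrm x.
Proof.
elim: n => [|n IH]; first by rewrite expr0 mul1r.
apply: le_trans (TM _) _; rewrite exprS -mulrA ler_wpM2l//.
exact: le_trans M1.
Qed.

(** A nonzero [s = S m y] is stretched to norm [t / 2], and the scalar [a] undoes the stretching:
    [a] lies in the disk because [s] is small, and [a T^m g] is small because [nrm (T^m g) * nrm s]
    is. Density then moves the stretched vector into [X]. *)
Lemma diskcyclicity_approx (n : nat -> nat) (X Y : set H) (S : nat -> H -> H) :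
  (forall k, (0 < n k)%N) -> dense X -> dense Y ->
  (forall x y, X x -> Y y ->
    `|iter (n k) T x| * `|S (n k) y| @[k --> \oo] --> (0 : R[i]^o)) ->
  (forall y, Y y -> S (n k) y @[k --> \oo] --> (0 : H)) ->
  (forall y, Y y -> iter (n k) T (S (n k) y) @[k --> \oo] --> y) ->
  forall (G : seq H) d (e t : R), (forall g, g \in G -> X g) -> 0 < e -> 0 < t ->
  exists w (a : R[i]) m,
    [/\ X w /\ (0 < m)%N, nrm w <= t, nrm a <= 1,
        forall g, g \in G -> nrm (a *: iter m T g) <= e &
        nrm (a *: iter m T w - d) <= e].
Proof.
move=> n0 /dense_nrmP Xd /dense_nrmP Yd TS S0 TSy G d e t GX e0 t0.
have e3 : 0 < e / 3 by rewrite divr_gt0.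
have t2 : 0 < t / 2 by rewrite divr_gt0.
have [y Yy dy] := Yd d _ e3.
have [k1 hk1] := (cvg_nrmP _ _).1 (S0 _ Yy) _ t2.
have [k2 hk2] := (cvg_nrmP _ _).1 (TSy _ Yy) _ e3.
(* The criterion treats one [g] at a time; finiteness of [G] gives a common threshold. *)
have [k3 hk3] : exists k3, forall k, (k3 <= k)%N -> forall g, g \in G ->
    nrm (iter (n k) T g) * nrm (S (n k) y) < e * (t / 2).
  elim: G GX => [|g G IH] GX; first by exists 0%N.
  have [|k4 h4] := IH; first by move=> f fG; apply: GX; rewrite inE fG orbT.
  have et : 0 < e * (t / 2) by rewrite mulr_gt0.
  have Xg : X g by apply: GX; rewrite mem_head.
  have [k5 h5] := (@cvg_nrmP _ R[i]^o _ _).1 (TS _ _ Xg Yy) _ et.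
  exists (maxn k4 k5) => k; rewrite geq_max => /andP[kk4 kk5] f.
  rewrite inE => /predU1P[->|]; last exact: h4.
  have := h5 _ kk5; rewrite subr0 !normE -rmorphM/= nrm_real//.
  by rewrite mulr_ge0// nrm_ge0.
pose k := maxn k1 (maxn k2 k3).
have {}hk1 : nrm (S (n k) y) < t / 2.
  by have := hk1 k (leq_maxl _ _); rewrite subr0.
have {}hk2 : nrm (iter (n k) T (S (n k) y) - y) < e / 3.
  by apply: hk2; rewrite /k !leq_max leqnn orbT.
have {}hk3 : forall g, g \in G ->
    nrm (iter (n k) T g) * nrm (S (n k) y) < e * (t / 2).
  by apply: hk3; rewrite /k !leq_max leqnn !orbT.
move: (n k) (n0 k) hk1 hk2 hk3 => m m0 hk1 hk2 hk3 {k}.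
set s := S m y in hk1 hk2 hk3.
(* When s = 0 this is the choice a = 0, w' = 0, which works as well. *)
pose a : R[i] := (nrm s / (t / 2))%:C; pose w' := a^-1 *: s.
have na : nrm a = nrm s / (t / 2) by rewrite nrm_real// divr_ge0 ?nrm_ge0 ?ltW.
have a1 : nrm a <= 1 by rewrite na ler_pdivrMr// mul1r ltW.
have [w'_small aw'] : nrm w' <= t / 2 /\ a *: iter m T w' = iter m T s.
  have [s0|s0] := eqVneq s 0.
    by rewrite /w' s0 scaler0 nrm0 iter_linear0 scaler0; split=> //; exact: ltW.
  have a0 : a != 0 by rewrite -nrm_eq0 na mulf_neq0 ?invr_eq0 ?nrm_eq0 ?gt_eqF.
  split; last by rewrite iter_linearZ scalerA divff// scale1r.
  have : nrm a * nrm w' = nrm s by rewrite -nrmZ scalerA divff// scale1r.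
  rewrite na => h; have s1 : 0 < nrm s by rewrite nrm_gt0.
  rewrite -(ler_pM2l s1) -[X in _ <= X * _]h le_eqVlt; apply/orP; left.
  by apply/eqP; field; rewrite gt_eqF.
have Mm : 0 < M ^+ m by rewrite exprn_gt0// (lt_le_trans _ M1).
(* [w] must remain close to [w'] after [m] applications of [T], hence the division by [M ^+ m]. *)
have [|w Xw ww'] := Xd w' (Num.min (t / 2) (e / 3 / M ^+ m)).
  by rewrite lt_min t2 divr_gt0.
move: ww'; rewrite lt_min => /andP[ww1]; rewrite ltr_pdivlMr// => ww2.
exists w, a, m; split=> //.
- by have := le_nrmB w' (w' - w); rewrite opprB subrKC; lra.
- move=> g gG; rewrite nrmZ na mulrAC ler_pdivrMr//.
  by rewrite mulrC ltW//; exact: hk3.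
have -> : a *: iter m T w - d =
    (iter m T s - y) - a *: iter m T (w' - w) - (d - y).
  rewrite iter_linearB scalerBr aw' !opprB.
  by rewrite [(iter m T s - y) + _]addrC subrKA subrKA.
apply: le_trans (le_nrmB _ _) _.
have := le_nrmB (iter m T s - y) (a *: iter m T (w' - w)).
have := nrm_iter m (w' - w).
rewrite nrmZ; have := ler_piMl (nrm_ge0 (iter m T (w' - w))) a1; lra.
Qed.

End Iterates.

(** Recursion over the whole history: [good] is the invariant on earlier entries that makes a
    further step possible, while [Q] ties the new entry to them. *)
Lemma history_choice (A : Type) (a0 : A) (good : A -> Prop)
  (Q : seq A -> A -> Prop) :
  (forall h, (forall i, (i < size h)%N -> good (nth a0 h i)) ->
    exists2 a, good a & Q h a) ->
  exists f : nat -> A, forall n, good (f n) /\ Q (mkseq f n) (f n).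
Proof.
move=> step.
have /choice[g hg] h : exists a, (forall i, (i < size h)%N -> good (nth a0 h i)) ->
    good a /\ Q h a.
  have [/step[a]|nh] := pselect (forall i, (i < size h)%N -> good (nth a0 h i)).
    by exists a.
  by exists a0.
pose hist := fix hist n := if n is m.+1 then rcons (hist m) (g (hist m)) else [::].
pose f n := g (hist n).
have histE n : hist n = mkseq f n.
  by elim: n => //= n IH; rewrite mkseqS -IH.
exists f => n; rewrite -histE; apply: (hg (hist n)).
elim: n => //= n IH i; rewrite size_rcons ltnS nth_rcons leq_eqVlt.
case: ltngtP => //= [ih _|_ _]; first exact: IH.
exact: (hg _ IH).1.
Qed.

Lemma mem_map_nth (A : Type) (a0 : A) (B : eqType) (f : A -> B) (h : seq A) y :
  reflect (exists2 i, (i < size h)%N & y = f (nth a0 h i)) (y \in map f h).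
Proof.
apply: (iffP (nthP (f a0))) => -[k]; rewrite ?size_map => kh.
  by rewrite (nth_map a0)// => <-; exists k.
by move=> ->; exists k; rewrite ?size_map// (nth_map a0).
Qed.

(* The data (e_s, x_s, w_s, a_s, n_s) chosen at one stage. *)
Record block (R : realType) (H : normedModType R[i]) := Block {
  unit_of : H; start_of : H; corr_of : H; coef_of : R[i]; time_of : nat }.

(** * Recursive choice of the stages *)

Section Construction.
Context {R : realType} {H : normedModType R[i]}.
Context (dot : {dot H for (@Num.conj R[i])}) (T : {linear H -> H}).
Context (M : R) (M1 : 1 <= M) (TM : forall x, nrm (T x) <= M * nrm x).
Context (X : set H) (X_dense : dense X).

Hypothesis small_unit : forall (s : seq H) (e : R), 0 < e ->
  exists v, [/\ nrm v = 1, forall f, f \in s -> dot v f = 0 & nrm (T v) <= e].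

Hypothesis stage :
  forall (G : seq H) d (e t : R), (forall g, g \in G -> X g) -> 0 < e -> 0 < t ->
  exists w (a : R[i]) m,
    [/\ X w /\ (0 < m)%N, nrm w <= t, nrm a <= 1,
        forall g, g \in G -> nrm (a *: iter m T g) <= e &
        nrm (a *: iter m T w - d) <= e].

(** Only finitely many times precede stage [s], so [T (e s)], [x s - e s] and [w s] can be made
    small enough for all of them; the new scalar and time then damp the earlier vectors and carry
    [w s] close to [d s]. *)
Lemma block_construction (eps del : nat -> R) (d : nat -> H) :
  (forall s, 0 < eps s) -> (forall s, 0 < del s) ->
  exists (e x w : nat -> H) (a : nat -> R[i]) (n : nat -> nat), forall s,
    [/\ nrm (e s) = 1 /\ (forall r, (r < s)%N -> dot (e s) (e r) = 0),
        nrm (x s - e s) <= eps s /\ nrm (w s) <= eps s,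
        forall r, (r < s)%N -> nrm (iter (n r) T (x s)) <= eps s /\
                               nrm (iter (n r) T (w s)) <= eps s,
        nrm (a s) <= 1 &
        [/\ forall j, (j <= s)%N -> nrm (a s *: iter (n s) T (x j)) <= del s,
            forall r, (r < s)%N -> nrm (a s *: iter (n s) T (w r)) <= del s &
            nrm (a s *: iter (n s) T (w s) - d s) <= del s]].
Proof.
move=> eps0 del0.
pose b0 := @Block R H 0 0 0 0 0%N.
pose good (b : block H) := [/\ X (start_of b), X (corr_of b) & (0 < time_of b)%N].
pose Q (h : seq (block H)) (b : block H) := let s := size h in
    [/\ nrm (unit_of b) = 1 /\
          (forall r, (r < s)%N -> dot (unit_of b) (unit_of (nth b0 h r)) = 0),
        nrm (start_of b - unit_of b) <= eps s /\ nrm (corr_of b) <= eps s,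
        forall r, (r < s)%N ->
          nrm (iter (time_of (nth b0 h r)) T (start_of b)) <= eps s /\
          nrm (iter (time_of (nth b0 h r)) T (corr_of b)) <= eps s,
        nrm (coef_of b) <= 1 &
        [/\ nrm (coef_of b *: iter (time_of b) T (start_of b)) <= del s,
            forall r, (r < s)%N ->
              nrm (coef_of b *: iter (time_of b) T (start_of (nth b0 h r)))
                <= del s /\
              nrm (coef_of b *: iter (time_of b) T (corr_of (nth b0 h r)))
                <= del s &
            nrm (coef_of b *: iter (time_of b) T (corr_of b) - d s) <= del s]].
have [|f hf] := @history_choice _ b0 good Q.
  move=> h h_good; set s := size h.
  pose p := (\max_(r < s) time_of (nth b0 h r))%N.
  have p_ge r : (r < s)%N -> (time_of (nth b0 h r) <= p)%N.
    by move=> rs; apply: (leq_bigmax (Ordinal rs)).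
  clearbody p.
  have M0 : 0 <= M by apply: le_trans M1.
  have L1 : 1 <= M ^+ p by exact: exprn_ege1.
  have L0 : 0 < M ^+ p by exact: lt_le_trans L1.
  have iterL r v : (r < s)%N ->
      nrm (iter (time_of (nth b0 h r)) T v) <= M ^+ p * nrm v.
    move=> rs; apply: le_trans (nrm_iter M1 TM _ _) _.
    by rewrite ler_wpM2r ?nrm_ge0// ler_weXn2l// p_ge.
  have iterTL r v : (r < s)%N ->
      nrm (iter (time_of (nth b0 h r)) T v) <= M ^+ p * nrm (T v).
    move=> rs; have [_ _] := h_good _ rs; have := p_ge _ rs.
    (* A positive time lets one factor [T] act first, so that smallness of [T v] can be used; this
       is why [good] demands positive times. *)
    case: (time_of _) => // t tp _; rewrite iterSr.
    apply: le_trans (nrm_iter M1 TM _ _) _.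
    by rewrite ler_wpM2r ?nrm_ge0// ler_weXn2l// ltnW.
  (* Half of [eps s] is spent on [T v] and half on [x - v], each amplified by at most [M ^+ p]. *)
  have e0 : 0 < eps s / 2 / M ^+ p by rewrite !divr_gt0.
  have [v [v1 v_orth Tv]] := small_unit [seq unit_of b | b <- h] e0.
  have [x Xx vx] := (dense_nrmP _).1 X_dense v _ e0.
  have t0 : 0 < eps s / M ^+ p by rewrite divr_gt0.
  (* The new [x] joins the list because stage [s] must damp [x s] as well. *)
  have [|w [a [m [[Xw m0] w_small a1 hG hw]]]] := @stage
    (x :: [seq start_of b | b <- h] ++ [seq corr_of b | b <- h]) (d s) (del s) _
    _ (del0 s) t0.
    move=> g; rewrite inE mem_cat => /predU1P[->//|].
    by case/orP => /(mem_map_nth b0)[i ih ->]; have [] := h_good _ ih.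
  move: vx; rewrite nrmB ltr_pdivlMr// => vx.
  move: Tv; rewrite ler_pdivlMr// => Tv.
  move: w_small; rewrite ler_pdivlMr// => w_small.
  exists (Block v x w a m) => //; rewrite /Q /= -/s; split=> //.
  - by split=> // r rs; apply: v_orth; apply/(mem_map_nth b0); exists r.
  - have := eps0 s; have := ler_peMr (nrm_ge0 (x - v)) L1.
    have := ler_peMr (nrm_ge0 w) L1; split; lra.
  - move=> r rs; split; last first.
      by apply: le_trans (iterL _ _ rs) _; rewrite mulrC.
    rewrite -(subrK v x) iter_linearD; apply: le_trans (le_nrmD _ _) _.
    by have := iterL _ (x - v) rs; have := iterTL _ v rs; lra.
  split=> //; first by apply: hG; rewrite mem_head.
  move=> r rs; split; apply: hG; rewrite inE mem_cat; apply/orP; right;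
    apply/orP; [left|right]; apply/(mem_map_nth b0); by exists r.
exists (fun s => unit_of (f s)), (fun s => start_of (f s)).
exists (fun s => corr_of (f s)), (fun s => coef_of (f s)), (fun s => time_of (f s)).
move=> s; have [_] := hf s; rewrite /Q size_mkseq.
move=> [[h1 h2] h3 h4 h5 [h6 h7 h8]]; split=> //.
- by split=> // r rs; have := h2 r rs; rewrite nth_mkseq.
- by move=> r rs; have := h4 r rs; rewrite nth_mkseq.
split=> //.
- move=> j; rewrite leq_eqVlt => /predU1P[->//|js].
  by have [] := h7 j js; rewrite nth_mkseq.
- by move=> r rs; have [_] := h7 r rs; rewrite nth_mkseq.
Qed.

End Construction.

(** * The perturbed identity and its image of the closed orthonormal span *)

Section Subspace.
Context {R : realType} {H : completeNormedModType R[i]}.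
Context (dot : {dot H for (@Num.conj R[i])}).
Hypothesis norm_dot : forall x : H, `|x| = sqrtC (dot x x).
Context (e x w : nat -> H) (idx : nat -> nat).
Hypothesis e1 : forall s, nrm (e s) = 1.
Hypothesis e_orth : forall s r, (r < s)%N -> dot (e s) (e r) = 0.
Hypothesis xe : forall s, nrm (x s - e s) <= 2^-1 ^+ s.+3.
Hypothesis w_small : forall s, nrm (w s) <= 2^-1 ^+ s.+3.

Let c (q : H) j : R[i] := dot q (e j).
Let P (q : H) m : H := \sum_(j < m) c q j *: e j.

Lemma dot_orthonormal i j : dot (e i) (e j) = (i == j)%:R.
Proof.
case: ltngtP => [ij|/e_orth//|->]; last by rewrite (dot_nrm norm_dot) e1 expr1n.
by apply: (dotC0 (dot := dot)); exact: e_orth.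
Qed.

Let cP a q q' j : c (a *: q + q') j = a * c q j + c q' j.
Proof. by rewrite /c linearDl/= linearZl_LR. Qed.

Let PP a q q' m : P (a *: q + q') m = a *: P q m + P q' m.
Proof.
rewrite /P scaler_sumr -big_split; apply: eq_bigr => j _.
by rewrite cP scalerDl scalerA.
Qed.

Let nrm_c q j : nrm (c q j) <= nrm q.
Proof. exact: nrm_dot_unit. Qed.

Let P_contract q m : nrm (q - P q m) <= nrm q.
Proof.
rewrite -[leRHS](congr1 nrm (subrK (P q m) q)); apply: (le_nrm_orth norm_dot).
rewrite /P linear_sumr big1// => j _; rewrite linearZr_LR/= linearBl linear_sumlz.
rewrite (bigD1 j)//= big1 => [|k kj]; rewrite linearZl_LR/= dot_orthonormal.
  by rewrite eqxx mulr1 addr0 subrr mulr0.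
by rewrite (inj_eq val_inj) (negbTE kj) mulr0.
Qed.

(** The closed span of the [e j], encoded by convergence of Fourier sums, the form that the
    estimates use. *)
Definition orthonormal_span : set H := [set q | P q @ \oo --> q].

(** The map [q |-> q - P q n] is a contraction for every [n], so convergence of Fourier sums passes
    to limits. *)
Lemma orthonormal_span_closed : closed orthonormal_span.
Proof.
move=> q /closure_nrmP clq; apply/cvg_nrmP => d d0.
have d2 : 0 < d / 2 by rewrite divr_gt0.
have [q' /cvg_nrmP/(_ _ d2)[m hm] qq'] := clq _ d2.
exists m => n /hm h.
have -> : P q n - q = (P q' n - q') - ((q - q') - P (q - q') n).
  have -> : P (q - q') n = P q n - P q' n.
    by rewrite addrC -scaleN1r PP scaleN1r addrC.
  rewrite !opprB [q' - q]addrC (addrACA (P q n)) [- P q' n + q']addrC [RHS]addrC.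
  by rewrite -(opprB (P q' n)) subrK.
apply: le_lt_trans (le_nrmB _ _) _.
by have := P_contract (q - q') n; lra.
Qed.

Lemma orthonormal_span_linear a q q' : orthonormal_span q -> orthonormal_span q' ->
  orthonormal_span (a *: q + q').
Proof.
move=> h h'; rewrite /orthonormal_span/= (_ : P _ = fun m => a *: P q m + P q' m).
  by apply: cvgD => //; exact: cvgZr.
by apply/funext => m; exact: PP.
Qed.

Lemma mem_orthonormal_span i : orthonormal_span (e i).
Proof.
apply/cvg_nrmP => d d0; exists i.+1 => m im.
rewrite /P (bigD1 (Ordinal im))//= big1 => [|k ki].
  by rewrite /c dot_orthonormal eqxx scale1r addr0 subrr nrm0.
rewrite /c dot_orthonormal -(inj_eq val_inj)/= in ki *.
by rewrite eq_sym (negbTE ki) scale0r.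
Qed.

Let S q m : H := \sum_(r < m) (c q r *: (x r - e r) + c q (idx r) *: w r).

(** The summand at [m] has two parts of norm at most [2^-1 ^+ m.+3 * nrm q], which together fill
    exactly the gap between consecutive bounds. *)
Let exists_perturbation : exists K : H -> H, forall q m,
  nrm (S q m - K q) <= 2^-1 ^+ m.+1 * nrm q.
Proof.
suff /choice[K hK] q : exists k, forall m, nrm (S q m - k) <= 2^-1 ^+ m.+1 * nrm q.
  by exists K.
apply: nrm_complete.
- move=> d /(exp2N_smallM (nrm q))[n hn]; exists n; move: hn; rewrite exp2NS.
  have := exp2N_gt0 (R := R) n; have := nrm_ge0 q; nra.
- by move=> m; rewrite mulr_ge0 ?nrm_ge0// ltW// exp2N_gt0.
move=> m; rewrite /S big_ord_recr/= addrAC subrr add0r.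
apply: le_trans (le_nrmD _ _) _; rewrite !nrmZ.
have h1 := ler_pM (nrm_ge0 _) (nrm_ge0 _) (nrm_c q m) (xe m).
have h2 := ler_pM (nrm_ge0 _) (nrm_ge0 _) (nrm_c q (idx m)) (w_small m).
by move: h1 h2; rewrite !exp2NS; lra.
Qed.

Let K := projT1 (cid exists_perturbation).

Let KP q m : nrm (S q m - K q) <= 2^-1 ^+ m.+1 * nrm q.
Proof. exact: (projT2 (cid exists_perturbation)). Qed.

(* The operator sending e_j to x_j + sum of the corrections w_r with idx r = j. *)
Definition perturb q := q + K q.

(** [K] is known only as the limit of the linear maps [S], so its linearity is obtained up to errors
    that vanish as [m] grows. *)
Lemma perturb_linear a q q' : perturb (a *: q + q') = a *: perturb q + perturb q'.
Proof.
rewrite /perturb scalerDr addrACA; congr +%R.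
apply/eqP; rewrite -subr_eq0 -nrm_eq0 eq_le nrm_ge0 andbT.
apply/ler_addgt0Pr => d d0; rewrite add0r.
have [m hm] :=
  exp2N_smallM (nrm (a *: q + q') + nrm a * nrm q + nrm q') d0.
have SP : S (a *: q + q') m = a *: S q m + S q' m.
  rewrite /S scaler_sumr -big_split; apply: eq_bigr => j _.
  by rewrite /= !cP !scalerDl (scalerDr a) !scalerA addrACA.
have -> : K (a *: q + q') - (a *: K q + K q') =
  (a *: (S q m - K q) + (S q' m - K q')) - (S (a *: q + q') m - K (a *: q + q')).
  by rewrite SP scalerBr addrACA -opprD opprB [RHS]addrC subrKA.
apply: le_trans (le_nrmB _ _) _.
have := le_nrmD (a *: (S q m - K q)) (S q' m - K q'); rewrite nrmZ.
have := ler_wpM2l (nrm_ge0 a) (KP q m); have := KP q' m.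
have := KP (a *: q + q') m; rewrite !exp2NS.
have := exp2N_gt0 (R := R) m; have := nrm_ge0 (a *: q + q').
have := mulr_ge0 (nrm_ge0 a) (nrm_ge0 q); have := nrm_ge0 q'.
nra.
Qed.

(** At [m = 0] the sum is empty and the rate itself bounds [K]; hence [perturb] is bounded below. *)
Let nrm_K q : nrm (K q) <= nrm q / 2.
Proof. by have := KP q 0; rewrite /S big_ord0 sub0r nrmN expr1; lra. Qed.

Lemma perturb_ge q : nrm q / 2 <= nrm (perturb q).
Proof.
have := le_nrmB (perturb q) (K q); rewrite /perturb addrK.
by have := nrm_K q; lra.
Qed.

Lemma perturb_le q : nrm (perturb q) <= 2 * nrm q.
Proof.
have := le_nrmD q (K q); have := nrm_K q; have := nrm_ge0 q.
by rewrite /perturb; lra.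
Qed.

Let perturbB q q' : perturb (q - q') = perturb q - perturb q'.
Proof. by rewrite addrC -scaleN1r perturb_linear scaleN1r addrC. Qed.

Let perturb0 : perturb 0 = 0.
Proof. by have := perturbB 0 0; rewrite !subrr. Qed.

Definition perturbed_span : set H := perturb @` orthonormal_span.

(** For closedness: [perturb] is bounded below, so preimages of a convergent sequence are Cauchy. *)
Lemma perturbed_span_subspace : closed_linear_subspace perturbed_span.
Proof.
split; last first.
  split; first rewrite inE.
    exists 0; last exact: perturb0.
    rewrite -(addNr (e 0)) -scaleN1r.
    by apply: orthonormal_span_linear; exact: mem_orthonormal_span.
  move=> b y z; rewrite !inE => -[q Eq <-] [q' Eq' <-].
  by exists (b *: q + q'); [exact: orthonormal_span_linear|exact: perturb_linear].
move=> y /closure_nrmP cly.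
have /choice[f hf] k : exists q, orthonormal_span q /\
    nrm (y - perturb q) < 2^-1 ^+ k.
  by have [_ [q Eq <-] h] := cly _ (exp2N_gt0 k); exists q.
(* By [perturb_ge], consecutive [f k] differ by at most [3 * 2^-1 ^+ k], the drop of [6 * 2^-1 ^+ k]
   from [k] to [k.+1]. *)
have [|||q hq] := @nrm_complete _ _ f (fun k => 6 * 2^-1 ^+ k).
- by move=> d /(exp2N_smallM 6).
- by move=> k; rewrite mulr_ge0// ltW// exp2N_gt0.
- move=> k; have := perturb_ge (f k.+1 - f k); rewrite perturbB.
  have := nrm_dist (perturb (f k.+1)) y (perturb (f k)).
  have [_] := hf k; have [_] := hf k.+1.
  rewrite [nrm (perturb (f k.+1) - y)]nrmB exp2NS; lra.
exists q.
  apply: orthonormal_span_closed; apply/closure_nrmP => d /(exp2N_smallM 6)[n hn].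
  by exists (f n); [exact: (hf n).1|rewrite nrmB; exact: le_lt_trans hn].
apply/eqP; rewrite eq_sym -subr_eq0 -nrm_eq0 eq_le nrm_ge0 andbT.
(* Here [13 = 1 + 2 * 6]: 1 from [hf], and 6 from [hq] doubled by [perturb_le]. *)
apply/ler_addgt0Pr => d /(exp2N_smallM 13)[n hn]; rewrite add0r.
apply: le_trans (nrm_dist _ (perturb (f n)) _) _.
have [_ h] := hf n; have := perturb_le (f n - q); rewrite perturbB.
by have := hq n; lra.
Qed.

(** The orthonormal [e j] are independent, and [perturb] is linear and injective. *)
Lemma perturbed_span_infinite : infinite_dimensional perturbed_span.
Proof.
apply: (@infinite_dimensional_free _ _ _ (perturb \o e)) => [i|n b].
  by exists (e i) => //; exact: mem_orthonormal_span.
have -> m : \sum_(k < m) b k *: (perturb \o e) k = perturb (\sum_(k < m) b k *: e k).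
  elim: m => [|m IH]; first by rewrite !big_ord0 perturb0.
  by rewrite !big_ord_recr/= IH [RHS](congr1 perturb (addrC _ _)) perturb_linear addrC.
move=> h k kn; have := perturb_ge (\sum_(k < n) b k *: e k).
rewrite h nrm0 => h0.
have {h0}/eqP h0 : \sum_(k < n) b k *: e k == 0.
  by rewrite -nrm_eq0 eq_le nrm_ge0 andbT; move: h0; lra.
have := linear0l dot (e k); rewrite -h0 linear_sumlz (bigD1 (Ordinal kn))//= big1.
  by rewrite linearZl_LR/= dot_orthonormal eqxx mulr1 addr0.
move=> j jk; rewrite linearZl_LR/= dot_orthonormal.
by rewrite -(inj_eq val_inj)/= in jk; rewrite (negbTE jk) mulr0.
Qed.

Context (T : {linear H -> H}).
Context (M : R) (M1 : 1 <= M) (TM : forall x, nrm (T x) <= M * nrm x).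
Context (d : nat -> H) (a : nat -> R[i]) (n : nat -> nat).
Hypothesis a1 : forall s, nrm (a s) <= 1.

(** The [s.+1] terms up to stage [s] share a budget of [2^-1 ^+ s / 2] evenly. *)
Let del s : R := 2^-1 ^+ s / (2 * s.+1%:R).

Hypothesis Tx : forall s r, (r < s)%N -> nrm (iter (n r) T (x s)) <= 2^-1 ^+ s.+3.
Hypothesis Tw : forall s r, (r < s)%N -> nrm (iter (n r) T (w s)) <= 2^-1 ^+ s.+3.
Hypothesis aTx : forall s j, (j <= s)%N -> nrm (a s *: iter (n s) T (x j)) <= del s.
Hypothesis aTw : forall s r, (r < s)%N -> nrm (a s *: iter (n s) T (w r)) <= del s.
Hypothesis aTd : forall s, nrm (a s *: iter (n s) T (w s) - d s) <= del s.

(** Applied termwise to the expansion of [perturb q], the map [a s T^(n s)] preserves essentially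
    only the correction [w s], whose coefficient is [c q (idx s)]. *)
Lemma stage_estimate s q : orthonormal_span q ->
  nrm (a s *: iter (n s) T (perturb q) - c q (idx s) *: d s)
    <= 2 * 2^-1 ^+ s * nrm q.
Proof.
move=> /cvg_nrmP Eq; set A := fun v => a s *: iter (n s) T v.
have AD v v' : A (v + v') = A v + A v' by rewrite /A iter_linearD scalerDr.
have AZ b v : A (b *: v) = b *: A v by rewrite /A iter_linearZ !scalerA mulrC.
have A0 : A 0 = 0 by rewrite /A iter_linear0 scaler0.
have A_le v : nrm (A v) <= M ^+ n s * nrm v.
  rewrite nrmZ; apply: le_trans (nrm_iter M1 TM _ _).
  by rewrite ler_piMl ?nrm_ge0.
(* Terms up to [s] are controlled by the choice of [a s] and [n s]; later ones were chosen small
   under the time [n s]. *)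
pose beta j := if (j <= s)%N then del s else 2^-1 ^+ j.+3.
have late j v : (s < j)%N -> nrm (iter (n s) T v) <= 2^-1 ^+ j.+3 ->
    nrm (A v) <= beta j.
  move=> sj h; rewrite /beta leqNgt sj/= nrmZ; apply: le_trans h.
  by rewrite ler_piMl ?nrm_ge0.
have bx j : nrm (A (x j)) <= beta j.
  have [js|sj] := leqP j s; first by rewrite /beta js; exact: aTx.
  by apply: late => //; exact: Tx.
have bw r : nrm (A (w r) - (r == s)%:R *: d s) <= beta r.
  case: (ltngtP r s) => [rs|sr|->]; rewrite ?scale0r ?subr0 ?scale1r.
  - by rewrite /beta ltnW//; exact: aTw.
  - by apply: late => //; exact: Tw.
  - by rewrite /beta leqnn; exact: aTd.
have sum_beta k : \sum_(j < s.+1 + k) beta j <= 2^-1 ^+ s.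
  have -> : 2^-1 ^+ s = s.+1%:R * del s + 2^-1 ^+ s / 2 :> R.
    have : s.+1%:R != 0 :> R by rewrite pnatr_eq0.
    by rewrite /del; move: (s.+1%:R) => N N0; field.
  rewrite big_split_ord/=; apply: lerD.
    rewrite (eq_bigr (fun=> del s)) => [|j _]; last by rewrite /beta -ltnS ltn_ord.
    by rewrite sumr_const card_ord mulr_natl.
  suff : \sum_(j < k) beta (s.+1 + j)%N <= 2^-1 ^+ s.+3 - 2^-1 ^+ (s + k).+3.
    have := exp2N_gt0 (R := R) (s + k).+3; have := exp2N_gt0 (R := R) s.
    by rewrite [2^-1 ^+ s.+3]exp2NS [2^-1 ^+ s.+2]exp2NS [2^-1 ^+ s.+1]exp2NS; lra.
  elim: k => [|k IH]; first by rewrite big_ord0 addn0 subrr.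
  rewrite big_ord_recr/= /beta leqNgt ltnS leq_addr/= addnS.
  by move: IH; rewrite addSn [2^-1 ^+ (s + k).+4]exp2NS; lra.
(* The estimate is proved for partial sums; the truncation error, amplified by at most [M ^+ n s],
   is absorbed in [eta]. *)
apply/ler_addgt0Pr => eta eta0.
have Mn0 : 0 < M ^+ n s by rewrite exprn_gt0// (lt_le_trans _ M1).
have eM : 0 < eta / 2 / M ^+ n s by rewrite !divr_gt0.
have [m1 hm1] := Eq _ eM.
have [m2 hm2] := exp2N_smallM (nrm q) eM.
(* The part [s.+1] ensures that the main term, at index [s], lies within the sum. *)
pose m := (s.+1 + (m1 + m2))%N.
have PS : P q m + S q m = \sum_(j < m) (c q j *: x j + c q (idx j) *: w j).
  rewrite /P /S -big_split; apply: eq_bigr => j _.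
  by rewrite /= addrA -scalerDr subrKC.
have main : nrm (A (P q m + S q m) - c q (idx s) *: d s) <= 2 * 2^-1 ^+ s * nrm q.
  have -> : A (P q m + S q m) - c q (idx s) *: d s =
      \sum_(j < m) (c q j *: A (x j) +
                    c q (idx j) *: (A (w j) - (j == s :> nat)%:R *: d s)).
    have sm : (s < m)%N by rewrite /m addSn ltnS leq_addr.
    have -> : c q (idx s) *: d s =
        \sum_(j < m) c q (idx j) *: ((j == s :> nat)%:R *: d s).
      rewrite (bigD1 (Ordinal sm))//= eqxx scale1r big1 ?addr0// => j js.
      by rewrite -(inj_eq val_inj)/= in js; rewrite (negbTE js) scale0r scaler0.
    rewrite PS (big_morph A AD A0) -sumrB; apply: eq_bigr => j _.
    by rewrite AD !AZ scalerBr addrA.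
  apply: le_trans (nrm_sum _) _.
  apply: (@le_trans _ _ (\sum_(j < m) 2 * nrm q * beta j)).
    apply: ler_sum => j _; apply: le_trans (le_nrmD _ _) _; rewrite !(nrmZ (c _ _)).
    have := ler_pM (nrm_ge0 _) (nrm_ge0 _) (nrm_c q j) (bx j).
    have := ler_pM (nrm_ge0 _) (nrm_ge0 _) (nrm_c q (idx j)) (bw j).
    lra.
  rewrite -mulr_sumr mulrAC mulrC [leRHS]mulrC.
  rewrite ler_wpM2l ?nrm_ge0// ler_wpM2l//; exact: sum_beta.
have -> : A (perturb q) - c q (idx s) *: d s =
    (A (P q m + S q m) - c q (idx s) *: d s) - (A (P q m - q) + A (S q m - K q)).
  have -> : A (P q m + S q m) = A (perturb q) + (A (P q m - q) + A (S q m - K q)).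
    by rewrite -!AD; congr A; rewrite /perturb addrACA !subrKC.
  by rewrite addrAC addrK.
apply: le_trans (le_nrmB _ _) _; apply: lerD => //.
apply: le_trans (le_nrmD _ _) _.
have h1 : nrm (A (P q m - q)) <= eta / 2.
  apply: le_trans (A_le _) _; rewrite mulrC -ler_pdivlMr//; apply/ltW/hm1.
  by rewrite /m addnCA leq_addr.
have h2 : nrm (A (S q m - K q)) <= eta / 2.
  apply: le_trans (A_le _) _; rewrite mulrC -ler_pdivlMr//.
  apply: le_trans (KP _ _) _; apply: le_trans (ltW hm2).
  rewrite mulrC ler_wpM2l ?nrm_ge0//.
  apply: ler_wiXn2l; rewrite ?invr_ge0 ?invf_le1 ?ler1n//.
  by rewrite /m -addSn addnA leq_addl.
by rewrite [leRHS]splitr; exact: lerD.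
Qed.

Hypothesis targets : forall i v (t : R) N, 0 < t ->
  exists s, [/\ (N <= s)%N, idx s = i & nrm (d s - v) < t].

(** Some coefficient [c q i] is nonzero; late stages that serve [i] with a target near
    [(c q i)^-1 *: v] bring [perturb q] close to [v]. *)
Lemma perturbed_span_diskcyclic y : perturbed_span y -> y <> 0 -> diskcyclic T y.
Proof.
move=> [q Eq <-] q0.
have [i ci] : exists i, c q i != 0.
  apply: contrapT => h; apply: q0.
  suff /eqP -> : q == 0 by exact: perturb0.
  rewrite -nrm_eq0 eq_le nrm_ge0 andbT; apply/ler_addgt0Pr => t t0.
  have /cvg_nrmP/(_ _ t0)[m /(_ m (leqnn m))] := Eq.
  rewrite /P big1 ?sub0r ?nrmN ?add0r => [/ltW//|j _].
  have [->|cj] := eqVneq (c q j) 0; first by rewrite scale0r.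
  by exfalso; apply: h; exists j.
apply/dense_nrmP => v t t0.
have t2 : 0 < t / 2 by rewrite divr_gt0.
have [N hN] := exp2N_smallM (2 * nrm q) t2.
have ci0 : 0 < nrm (c q i) by rewrite nrm_gt0.
have t3 : 0 < t / 2 / nrm (c q i) by rewrite divr_gt0.
have [s [Ns si ds]] := targets i ((c q i)^-1 *: v) N t3.
exists (a s *: iter (n s) T (perturb q)).
  by exists (n s), (a s); split=> //; rewrite normE lecR.
have := stage_estimate s Eq; rewrite si => est.
have near_v : nrm (c q i *: d s - v) < t / 2.
  have -> : c q i *: d s - v = c q i *: (d s - (c q i)^-1 *: v).
    by rewrite scalerBr scalerA divff// scale1r.
  by rewrite nrmZ mulrC -ltr_pdivlMr.
have small : 2 * 2^-1 ^+ s * nrm q < t / 2.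
  apply: le_lt_trans hN; rewrite mulrAC ler_wpM2l ?mulr_ge0 ?nrm_ge0//.
  by apply: ler_wiXn2l; rewrite ?invr_ge0 ?invf_le1 ?ler1n.
rewrite nrmB; apply: le_lt_trans (nrm_dist _ (c q i *: d s) _) _; lra.
Qed.

End Subspace.

(* A schedule in which every pair (coordinate, target) recurs infinitely often:
   it is read off the 2-adic valuation of the stage. *)
Lemma exists_schedule {R : realType} {H : normedModType R[i]} :
  separable_space H -> exists (idx : nat -> nat) (d : nat -> H),
    forall i v (t : R) N, 0 < t ->
      exists s, [/\ (N <= s)%N, idx s = i & nrm (d s - v) < t].
Proof.
move=> [D /pfcard_geP[->|[f]] /dense_nrmP Dd].
  by have [] := Dd 0 1 ltr01.
pose code s := odflt (0%N, 0%N) (unpickle (logn 2 s)).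
exists (fun s => (code s).1), (fun s => f (code s).2) => i v t N t0.
have [y Dy vy] := Dd v t t0.
have [l _ fl] := 'surj_f Dy.
(* The odd factor [3 ^ N] pushes the stage past [N] without changing its 2-adic valuation. *)
have code_s : code (2 ^ pickle (i, l) * 3 ^ N)%N = (i, l).
  by rewrite /code lognM ?expn_gt0// pfactorK// lognX muln0 addn0 pickleK.
exists (2 ^ pickle (i, l) * 3 ^ N)%N; rewrite code_s /= fl nrmB; split=> //.
apply: leq_trans (leq_pmull _ _); last by rewrite expn_gt0.
by rewrite ltnW// ltn_expl.
Qed.

Theorem proposition3p6 (R : realType) (H : completeNormedModType R[i])
  (dot : {dot H for (@Num.conj R[i])})
  (norm_dot : forall x : H, `|x| = sqrtC (dot x x))
  (H_infinite : infinite_dimensional [set: H])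
  (H_separable : separable_space H)
  (T : {linear H -> H}) (T_bounded : bounded_operator T)
  (T_criterion : diskcyclicity_criterion T)
  (u : nat -> H) (u_basic : normalized_basic_sequence u)
  (Tu_cvg0 : T (u m) @[m --> \oo] --> (0 : H)) :
  exists W : set H,
    [/\ closed_linear_subspace W, infinite_dimensional W &
        forall x, W x -> x <> 0 -> diskcyclic T x].
Proof.
have [M M1 TM] := bounded_operator_ge1 T_bounded.
have [u1 [_ u_exp]] := u_basic.
have seriesE a : series (fun m => a m *: u m) = fun n => \sum_(k < n) a k *: u k.
  by apply/funext => n; rewrite seriesEord.
have [||x a b|C C0 hC] := @schauder_coef_bound _ _ _ norm_dot u.
- by move=> m; rewrite /nrm u1.
- by move=> x /u_exp[a [ax _]]; exists a; rewrite -seriesE.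
- move=> ax bx.
  (* Uniqueness of expansions is granted only on the closed span, so the limit is first placed
     there. *)
  have /u_exp[c [_ c_uniq]] : closure (linear_span (range u)) x.
    apply: (@closed_cvg _ _ \oo _ (fun n => \sum_(k < n) a k *: u k)) ax.
      exact: closed_closure.
    apply: nearW => n; apply: subset_closure.
    by exists n, (fun i => a i), (fun i => u i); split=> // i; exists (i : nat).
  by rewrite -(c_uniq a) ?seriesE// -(c_uniq b) ?seriesE.
have [n [X [Y [S [[n0 _] [Xd Yd] TS S0 TSy]]]]] := T_criterion.
have [idx [d targets]] := exists_schedule H_separable.
(* These tolerances keep [perturb] within half the norm of the identity and the error at stage [s]
   within [2 * 2^-1 ^+ s * nrm q]. *)
have [||e [x [w [a [m hm]]]]] := block_construction M1 TM Xd
  (small_orth_unit dot C0 hC Tu_cvg0) (diskcyclicity_approx M1 TM n0 Xd Yd TS S0 TSy)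
  (eps := fun s => 2^-1 ^+ s.+3) (del := fun s => 2^-1 ^+ s / (2 * s.+1%:R)) d.
- by move=> s; exact: exp2N_gt0.
- by move=> s; rewrite divr_gt0 ?exp2N_gt0// mulr_gt0.
have e1 s : nrm (e s) = 1 by have [[]] := hm s.
have e_orth s r : (r < s)%N -> dot (e s) (e r) = 0.
  by have [[_ h] _ _ _ _] := hm s; exact: h.
have xe s : nrm (x s - e s) <= 2^-1 ^+ s.+3 by have [_ []] := hm s.
have w_small s : nrm (w s) <= 2^-1 ^+ s.+3 by have [_ []] := hm s.
exists (perturbed_span norm_dot idx e1 xe w_small); split.
- exact: perturbed_span_subspace.
- exact: perturbed_span_infinite.
apply: (perturbed_span_diskcyclic M1 TM (d := d) (a := a) (n := m)) => //.
- by move=> s; have [_ _ _] := hm s.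
- by move=> s r rs; have [_ _ /(_ r rs)[]] := hm s.
- by move=> s r rs; have [_ _ /(_ r rs)[]] := hm s.
- by move=> s; have [_ _ _ _ []] := hm s.
- by move=> s; have [_ _ _ _ []] := hm s.
- by move=> s; have [_ _ _ _ []] := hm s.
Qed.
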